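(* A ring $R$ is a strongly nil-clean ring if and only if $R$ is a semipotent UU ring.
   Context: Rings are associative with identity, not necessarily commutative. $J(R)$, $U(R)$ and ${\rm Nil}(R)$ denote the Jacobson radical, the unit group and the set of nilpotent elements of $R$. $R$ is strongly nil-clean if every $a\in R$ can be written $a=e+b$ with $e^2=e\in R$, $b\in{\rm Nil}(R)$ and $eb=be$. $R$ is a UU ring if $U(R)=1+{\rm Nil}(R)$. $R$ is semipotent if every right ideal of $R$ not contained in $J(R)$ contains a nonzero idempotent. *)

(* Defs.v *)
From HB Require Import structures.
From mathcomp Require Import all_boot all_algebra.
From mathcomp Require Import boolp classical_sets.

Set Implicit Arguments.
Unset Strict Implicit.
Unset Printing Implicit Defensive.

Import GRing.Theory.
Local Open Scope classical_set_scope.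
Local Open Scope ring_scope.

Definition idempotents (R : pzRingType) : set R := [set e | e ^+ 2 = e].

Definition nilpotents (R : pzRingType) : set R := [set b | exists n : nat, b ^+ n = 0].

(* [GRing.unit] would require a [unitRingType], i.e. a nontrivial ring given
   with a boolean test for invertibility. *)
Definition units (R : pzRingType) : set R :=
  [set u | exists v : R, u * v = 1 /\ v * u = 1].

(* The [idealr_closed] of [ring_quotient] is closed under multiplication on the
   left and is restricted to proper ideals given by boolean predicates. *)
Definition right_ideal (R : pzRingType) (I : set R) : Prop :=
  [/\ I 0, forall x y, I x -> I y -> I (x - y)
    & forall x r, I x -> I (x * r)].

Definition maximal_right_ideal (R : pzRingType) (M : set R) : Prop :=
  [/\ right_ideal M, M <> setT
    & forall I : set R, right_ideal I -> M `<=` I -> I = M \/ I = setT].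

(* The intersection of the maximal left ideals is the same set. If [R] is the
   zero ring there is no maximal right ideal and the radical is [setT]. *)
Definition jacobson (R : pzRingType) : set R :=
  \bigcap_(M in @maximal_right_ideal R) M.

Definition strongly_nil_clean (R : pzRingType) : Prop :=
  forall a : R, exists e b : R,
    [/\ idempotents e, nilpotents b, a = e + b & e * b = b * e].

Definition UU (R : pzRingType) : Prop :=
  @units R = [set 1 + b | b in @nilpotents R].

Definition semipotent (R : pzRingType) : Prop :=
  forall I : set R, right_ideal I -> ~ (I `<=` @jacobson R) ->
    exists e : R, [/\ I e, idempotents e & e != 0].

(* Main.v *)
(* If R is strongly nil-clean and a = e + b, then e = a e (1 + b)^-1 lies in aR,
   so a right ideal without nonzero idempotents is nil, hence contained in J(R).
   A unit u = e + b forces (1 - e) u^n = (1 - e) b^n = 0 for large n, so e = 1.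

   Conversely let R be semipotent and UU. Units lift modulo J(R), so in
   S = R / J(R) every unit is unipotent, and every nonzero xS contains a nonzero
   idempotent. A nonzero x with x^2 = 0 would produce 2 x 2 matrix units in S
   (Levitzki), hence a unit that is not unipotent; so S is reduced, its
   idempotents are central and 1 is its only unit. A nonzero idempotent e in
   (a - a^2)S would make ae a unit of eS, whence ae = e and e = 0; so S is
   Boolean. As 1 + J(R) consists of units, J(R) is nil, every a - a^2 is
   nilpotent, and a is congruent to an idempotent polynomial in a
   modulo a nilpotent one. *)
Require Import Defs.
From HB Require Import structures.
From mathcomp Require Import all_boot all_algebra.
From mathcomp Require Import boolp classical_sets.

Set Implicit Arguments.
Unset Strict Implicit.
Unset Printing Implicit Defensive.

Import GRing.Theory.
Local Open Scope classical_set_scope.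
Local Open Scope ring_scope.
Local Open Scope quotient_scope.

(** * Inverses and nilpotent elements *)

Lemma left_right_inverse_eq (R : pzRingType) (x y z : R) :
  x * y = 1 -> y * z = 1 -> x = z.
Proof. by move=> xy yz; rewrite -[x]mulr1 -yz mulrA xy mul1r. Qed.

Lemma sub1rX (R : pzRingType) (x : R) (n : nat) :
  1 - x ^+ n = (1 - x) * \sum_(i < n) x ^+ i.
Proof. by rewrite -[LHS]opprB subrX1 -mulNr opprB. Qed.

Lemma units_1D_nilpotent (R : pzRingType) (b : R) :
  nilpotents b -> units (1 + b).
Proof.
case=> n bn0; set s := \sum_(i < n) (- b) ^+ i.
have sE : (1 + b) * s = 1.
  by rewrite -{1}[b]opprK -sub1rX exprNn bn0 mulr0 subr0.
exists s; split=> //; rewrite -[RHS]sE; apply: commr_sym; apply: commr_sum => i _.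
apply: commrX; apply: commrN; apply: commr_sym; apply: commrD => //.
exact: commr1.
Qed.

(** * Maximal right ideals and the Jacobson radical *)

Lemma maximal_right_ideal_exists (R : pzRingType) (I : set R) :
  right_ideal I -> ~ I 1 -> exists2 M, maximal_right_ideal M & I `<=` M.
Proof.
move=> rI I1.
(* [I `|` A] rather than [A], so that the empty chain has an upper bound. *)
pose P A := right_ideal (I `|` A) /\ ~ (I `|` A) 1.
have [|A [[rA A1] maxA]] := @Zorn_bigcup R P.
  move=> F FP Ftot; have [[A0 FA0]|F0] := pselect (exists A, F A); last first.
    suff -> : \bigcup_(X in F) X = set0 by rewrite /P setU0.
    by rewrite -subset0 => x [X FX]; case: F0; exists X.
  have UE x : (I `|` \bigcup_(X in F) X) x <-> exists2 X, F X & (I `|` X) x.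
    split=> [[Ix|[X FX Xx]]|[X FX [Ix|Xx]]].
    - by exists A0 => //; left.
    - by exists X => //; right.
    - by left.
    - by right; exists X.
  split=> //; last by move=> /UE[X /FP[_ X1]].
  split.
  - by left; case: rI.
  - move=> x y /UE[X FX Xx] /UE[Y FY Yy]; apply/UE.
    case: (Ftot _ _ FX FY) => XY.
      exists Y => //; have [[_ sY _] _] := FP _ FY; apply: sY => //.
      by case: Xx => [|/XY]; [left|right].
    exists X => //; have [[_ sX _] _] := FP _ FX; apply: sX => //.
    by case: Yy => [|/XY]; [left|right].
  - move=> x r /UE[X FX Xx]; apply/UE; exists X => //.
    by have [[_ _ mX] _] := FP _ FX; exact: mX.
exists (I `|` A); last by move=> x; left.
split=> //; first by move=> AT; apply: A1; rewrite AT.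
move=> K rK AK; have [K1|K1] := pselect (K 1); [right|left].
  by rewrite -subTset => x _; case: rK => _ _ /(_ 1 x K1); rewrite mul1r.
apply/seteqP; split=> // x Kx; apply: contrapT => nx.
have IK : I `|` K = K by apply: setUidr => y Iy; apply: AK; left.
apply: (maxA K); last by rewrite /P IK.
split=> [|KA]; first by move=> y Ay; apply: AK; right.
by apply: nx; right; exact: KA.
Qed.

(** If [1 - x * r] had no right inverse, the right ideal it generates would lie in a maximal [M];
    this [M] also contains [x], hence [1]. Conversely, for [x] outside a maximal [M], the right
    ideal M + xR is everything, which puts some [1 - x * r] in [M]. *)
Lemma jacobsonP (R : pzRingType) (x : R) :
  jacobson x <-> forall r, exists v, (1 - x * r) * v = 1.
Proof.
split=> [Jx r|Hx M maxM].
  apply: contrapT => nv; pose I := [set y | exists v, y = (1 - x * r) * v].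
  have rI : right_ideal I.
    split; first by exists 0; rewrite mulr0.
    - by move=> _ _ [v ->] [w ->]; exists (v - w); rewrite mulrBr.
    - by move=> _ s [v ->]; exists (v * s); rewrite mulrA.
  have [|M maxM IM] := maximal_right_ideal_exists rI.
    by case=> v /esym v1; apply: nv; exists v.
  case: (maxM) => -[M0 MB MM] MT _; apply: MT; rewrite -subTset => y _.
  have M1xr : M (1 - x * r) by apply: IM; exists 1; rewrite mulr1.
  have Mxr : M (x * r) by apply: MM; exact: Jx.
  have MN : M (- (x * r)) by rewrite -sub0r; exact: MB.
  have := MB _ _ M1xr MN; rewrite opprK subrK => M1.
  by rewrite -[y]mul1r; exact: MM.
case: (maxM) => -[M0 MB MM] MT Mmax; apply: contrapT => nMx.
pose K := [set y | exists2 m, M m & exists r, y = m + x * r].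
have rK : right_ideal K.
  split; first by exists 0 => //; exists 0; rewrite mulr0 addr0.
  - move=> _ _ [m Mm [r ->]] [n Mn [s ->]]; exists (m - n); first exact: MB.
    by exists (r - s); rewrite mulrBr opprD addrACA.
  - move=> _ s [m Mm [r ->]]; exists (m * s); first exact: MM.
    by exists (r * s); rewrite mulrDl mulrA.
have MK : M `<=` K by move=> m Mm; exists m => //; exists 0; rewrite mulr0 addr0.
case: (Mmax K rK MK) => KE.
  by apply: nMx; rewrite -KE; exists 0 => //; exists 1; rewrite mulr1 add0r.
have : K 1 by rewrite KE.
case=> m Mm [r m1]; have [v] := Hx r; rewrite [X in X - _]m1 addrK => mv.
by apply: MT; rewrite -subTset => y _; rewrite -[y]mul1r -mv -mulrA; exact: MM.
Qed.

Lemma jacobsonB (R : pzRingType) (x y : R) :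
  jacobson x -> jacobson y -> jacobson (x - y).
Proof.
move=> Jx Jy M mM; case: (mM) => -[_ MB _] _ _.
by apply: MB; [exact: Jx | exact: Jy].
Qed.

Lemma jacobson0 (R : pzRingType) : jacobson (0 : R).
Proof. by move=> M [[]]. Qed.

Lemma jacobsonMr (R : pzRingType) (x r : R) : jacobson x -> jacobson (x * r).
Proof. by move=> Jx M mM; case: (mM) => -[_ _ MM] _ _; apply: MM; exact: Jx. Qed.

(** A formal geometric series gives (1 - ab)^-1 = 1 + a (1 - ba)^-1 b. This is what makes the
    radical absorb multiplication on the left. *)
Lemma right_inverse_1BC (R : pzRingType) (a b v : R) :
  (1 - b * a) * v = 1 -> (1 - a * b) * (1 + a * v * b) = 1.
Proof.
move=> bav; have abC : (1 - a * b) * a = a * (1 - b * a).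
  by rewrite mulrBl mulrBr mul1r mulr1 mulrA.
by rewrite mulrDr mulr1 !mulrA abC -[a * _ * v]mulrA bav mulr1 subrK.
Qed.

Lemma jacobsonMl (R : pzRingType) (s x : R) : jacobson x -> jacobson (s * x).
Proof.
move=> /jacobsonP Jx; apply/jacobsonP => r; have [v] := Jx (r * s).
by rewrite mulrA => /right_inverse_1BC vE; exists (1 + s * v * (x * r)); rewrite -mulrA.
Qed.

(** A right inverse [v] of [1 - j] equals [1 + j * v], so it has a right inverse too, which must be
    [1 - j]. *)
Lemma units_1B_jacobson (R : pzRingType) (j : R) : jacobson j -> units (1 - j).
Proof.
move=> Jj; have [v jv] := (jacobsonP j).1 Jj 1; rewrite mulr1 in jv.
have [w] := (jacobsonP (j * - v)).1 (jacobsonMr _ Jj) 1.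
have -> : 1 - j * - v * 1 = v.
  by rewrite mulr1 mulrN opprK -jv mulrBl mul1r subrK.
by move=> vw; exists v; split=> //; rewrite (left_right_inverse_eq jv vw).
Qed.

Lemma jacobson_idempotent (R : pzRingType) (e : R) :
  jacobson e -> idempotents e -> e = 0.
Proof.
move=> /units_1B_jacobson[v [ev _]] ee.
by rewrite -[e]mulr1 -ev mulrA mulrBr mulr1 -expr2 ee subrr mul0r.
Qed.

(** * Quotients by two-sided ideals *)

Lemma quotient_ring (R : pzRingType) (I : set R) :
  I 0 -> (forall x y, I x -> I y -> I (x - y)) ->
  (forall x r, I x -> I (x * r)) -> (forall r x, I x -> I (r * x)) ->
  exists (S : pzRingType) (f : {rmorphism R -> S}),
    (forall y, exists x, f x = y) /\ (forall x, f x = 0 <-> I x).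
Proof.
move=> I0 IB IMr IMl.
pose P : {pred R} := fun x => `[< I x >].
have PE x : (x \in P) = `[< I x >] by [].
have Pz : zmod_closed P.
  split=> [|x y]; rewrite !PE; first exact/asboolP.
  by move=> /asboolP Ix /asboolP Iy; apply/asboolP; exact: IB.
pose J : zmodClosed R := HB.pack P (GRing.isZmodClosed.Build R P Pz).
(* [J] is packed only as an additive subgroup, so [S] is the quotient group; its product is defined
   next through representatives. *)
pose S := {ideal_quot J}.
have piE x y : (\pi_S x = \pi_S y) <-> I (x - y).
  split=> [/eqP|Ixy]; first by rewrite -Quotient.idealrBE => /asboolP.
  by apply/eqP; rewrite -Quotient.idealrBE; apply/asboolP.
have [mul pi_mul] : exists mul : S -> S -> S, {morph \pi_S : x y / x * y >-> mul x y}.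
  exists (fun x y => \pi_S (repr x * repr y)) => x y.
  apply/piE; set x' := repr _; set y' := repr _.
  have -> : x * y - x' * y' = x * (y - y') + (x - x') * y'.
    by rewrite mulrBr mulrBl addrA subrK.
  have Ix : I (x - x') by apply/piE; rewrite reprK.
  have Iy : I (y - y') by apply/piE; rewrite reprK.
  rewrite -[(x - x') * y']opprK; apply: (IB); first exact: IMl.
  by rewrite -sub0r; apply: IB => //; exact: IMr.
have piD : {morph \pi_S : x y / x + y}.
  exact: Quotient.pi_add.
have mulA : associative mul.
  by move=> x y z; rewrite -[x]reprK -[y]reprK -[z]reprK -!pi_mul mulrA.
have mul1 : left_id (\pi_S 1) mul.
  by move=> x; rewrite -[x]reprK -!pi_mul mul1r.
have mulr1 : right_id (\pi_S 1) mul.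
  by move=> x; rewrite -[x]reprK -!pi_mul mulr1.
have mulDl : left_distributive mul +%R.
  by move=> x y z; rewrite -[x]reprK -[y]reprK -[z]reprK -piD -!pi_mul mulrDl piD.
have mulDr : right_distributive mul +%R.
  by move=> x y z; rewrite -[x]reprK -[y]reprK -[z]reprK -piD -!pi_mul mulrDr piD.
pose T : pzRingType := HB.pack S
  (GRing.Zmodule_isPzRing.Build S mulA mul1 mulr1 mulDl mulDr).
pose f : R -> T := \pi_S.
have fB : zmod_morphism f by exact: raddfB.
have fM : monoid_morphism f by split=> // x y; exact: pi_mul.
exists T, (HB.pack_for {rmorphism R -> T} f (GRing.isZmodMorphism.Build R T f fB)
  (GRing.isMonoidMorphism.Build R T f fM)).
split=> [y|x]; first by exists (repr y); exact: reprK.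
rewrite /= -[X in I X]subr0 -piE.
by have -> : \pi_S 0 = 0 :> S by exact: raddf0.
Qed.

(** * Unipotent units and matrix units *)

Lemma UU_unit_subr1_nilpotent (R : pzRingType) (u : R) :
  UU R -> units u -> nilpotents (u - 1).
Proof. by rewrite /UU => -> [b nb <-]; rewrite addrC addKr. Qed.

(* In matrix units a = E_12 and b = E_21 the unit (1 + a)(1 + b) differs from 1
   by n = [[1, 1], [1, 0]], which is invertible in the corner of ab + ba. *)
Lemma no_matrix_units (R : pzRingType) (a b : R) :
  (forall u : R, units u -> nilpotents (u - 1)) ->
  a * a = 0 -> b * b = 0 -> a * b * a = a -> b * a * b = b -> a = 0.
Proof.
move=> unip aa bb aba bab.
have inv_sq0 (c : R) : c * c = 0 -> (1 + c) * (1 - c) = 1 /\ (1 - c) * (1 + c) = 1.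
  by move=> cc; rewrite mulrBr mulrDr !mulr1 mulrDl mulrBl mul1r cc subr0 addr0 addrK subrK.
have [a1 a2] := inv_sq0 a aa; have [b1 b2] := inv_sq0 b bb.
set n := a + b + a * b; set m := a + b - b * a; set p := a * b + b * a.
have nE : (1 + a) * (1 + b) - 1 = n.
  by rewrite mulrDr mulr1 mulrDl mul1r addrC -[1 + a + _]addrA addKr addrA.
have [k nk0] : nilpotents n.
  rewrite -nE; apply: unip; exists ((1 - b) * (1 - a)); split.
    by rewrite mulrA -[_ * (1 - b)]mulrA b1 mulr1.
  by rewrite mulrA -[_ * (1 + a)]mulrA a2 mulr1.
have nm : n * m = p.
  have am : a * m = a * b - a by rewrite mulrBr mulrDr aa add0r mulrA aba.
  have bm : b * m = b * a by rewrite mulrBr mulrDr bb addr0 mulrA bb mul0r subr0.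
  by rewrite !mulrDl am bm -mulrA bm mulrA aba addrAC subrK.
have ap : a * p = a by rewrite mulrDr !mulrA aa mul0r add0r.
have np : n * p = n.
  have bp : b * p = b by rewrite mulrDr !mulrA bb mul0r addr0.
  by rewrite !mulrDl ap bp -mulrA bp.
(* The exponents start at one: exponent zero would give [1] instead of [p]. *)
have nmk : n ^+ k.+1 * m ^+ k.+1 = p.
  elim: {nk0}k => [|k IH]; first by rewrite !expr1.
  rewrite [n ^+ _]exprSr [m ^+ _]exprS mulrA -[_ * n * m]mulrA nm.
  by rewrite [n ^+ _]exprSr -[_ * n * p]mulrA np -exprSr.
by rewrite -ap -nmk exprS nk0 mulr0 mul0r mulr0.
Qed.

(** * Rings with unipotent units and a nonzero idempotent in every nonzero right ideal *)

Section SemiprimitiveUU.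

Variable R : pzRingType.
Hypothesis unip : forall u : R, units u -> nilpotents (u - 1).
Hypothesis idem : forall x : R, x != 0 -> exists r, idempotents (x * r) /\ x * r != 0.

Lemma square_zero_eq0 (x : R) : x * x = 0 -> x = 0.
Proof.
move=> xx; apply/eqP; apply: contrapT => /negP /idem[r].
set e := x * r => -[ee0]; have ee : e * e = e := ee0.
case/negP; apply/eqP.
have xe : x * e = 0 by rewrite mulrA xx mul0r.
have [y xy ye] : exists2 y, x * y = e & y * e = y.
  by exists (r * e); [rewrite mulrA | rewrite -[LHS]mulrA ee].
(* [e * x] and [b] are to be E_12 and E_21. The element [y] need not square to zero; the correction
   term gives [b * y = 0], hence [b * b = 0], and keeps [b * e = y] because [x * e = 0]. *)
clearbody e; pose b := y - y * y * x.
have be : b * e = y by rewrite mulrBl ye -[_ * x * e]mulrA xe mulr0 subr0.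
have ab : e * x * b = e - e * y * x.
  by rewrite mulrBr -!mulrA ![x * (y * _)]mulrA xy !mulrA ee.
have ex0 : e * x = 0.
  apply: (no_matrix_units (b := b)) => //.
  - by rewrite mulrA -[e * x * e]mulrA xe mulr0 mul0r.
  - have by0 : b * y = 0.
      by rewrite mulrBl -[_ * x * y]mulrA xy -[y * y * e]mulrA ye subrr.
    by rewrite {2}/b mulrBr !mulrA by0 !mul0r subrr.
  - by rewrite ab mulrBl !mulrA -[_ * x * e]mulrA xe mulr0 mul0r subr0 ee.
  - by rewrite -mulrA ab mulrBr !mulrA be.
by rewrite -ee -[X in e * X]xy mulrA ex0 mul0r.
Qed.

Lemma nilpotent_eq0 (b : R) : nilpotents b -> b = 0.
Proof.
case=> n; elim: n => [|[|n] IH] bn0; first by rewrite -[b]mulr1 -[1](expr0 b) bn0 mulr0.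
  by rewrite -[b]expr1.
(* The square of [b ^+ n.+1] has exponent 2n + 2, at least the n + 2 at which [b] vanishes. *)
by apply/IH/square_zero_eq0; rewrite -exprD addSnnS exprD bn0 mulr0.
Qed.

(** Both [e * x * (1 - e)] and [(1 - e) * x * e] square to zero, so [e * x] and [x * e] both equal
    [e * x * e]. *)
Lemma idempotent_central (e x : R) : e * e = e -> e * x = x * e.
Proof.
move=> ee.
have e1e : e * (1 - e) = 0 by rewrite mulrBr mulr1 ee subrr.
have e1e' : (1 - e) * e = 0 by rewrite mulrBl mul1r ee subrr.
have /eqP : e * x * (1 - e) = 0.
  by apply: square_zero_eq0; rewrite !mulrA -[_ * (1 - e) * e]mulrA e1e' mulr0 !mul0r.
rewrite mulrBr mulr1 subr_eq0 => /eqP ->.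
have /eqP : (1 - e) * x * e = 0.
  by apply: square_zero_eq0; rewrite !mulrA -[_ * e * (1 - e)]mulrA e1e mulr0 !mul0r.
by rewrite !mulrBl mul1r subr_eq0 => /eqP.
Qed.

Lemma semiprimitive_UU_boolean (a : R) : a * a = a.
Proof.
apply/esym/eqP; rewrite -subr_eq0; apply: contrapT => /negP /idem[r].
set e := _ * r => -[ee0]; have ee : e * e = e := ee0.
have are : a * (1 - a) * r = e by rewrite mulrBr mulr1.
clearbody e; case/negP; apply/eqP.
(* In the corner of [e], the relation [a * (1 - a) * r = e] makes [(1 - a) * r * e] a right inverse
   of [a * e]; adding [1 - e] extends both to the whole ring. *)
pose u := a * e + (1 - e); pose v := (1 - a) * r * e + (1 - e).
have e1e : e * (1 - e) = 0 by rewrite mulrBr mulr1 ee subrr.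
have eC x := idempotent_central x ee.
have uv : u * v = 1.
  have fe x : (1 - e) * (x * e) = 0 by rewrite -eC mulrA mulrBl mul1r ee subrr mul0r.
  have ff : (1 - e) * (1 - e) = 1 - e by rewrite mulrBl mul1r e1e subr0.
  rewrite mulrDl [a * e * v]mulrDr [(1 - e) * v]mulrDr fe ff.
  rewrite -[a * e * (1 - e)]mulrA e1e mulr0 addr0 add0r.
  by rewrite -[a * e * _]mulrA eC !mulrA -[_ * e * e]mulrA ee are ee addrC subrK.
(* The idempotent [v * u] is central, so [v * u * u = u * v * u = u]; multiplying by [v] on the
   right gives the claim. *)
have vu : v * u = 1.
  have ww : v * u * (v * u) = v * u by rewrite mulrA -[v * u * v]mulrA uv mulr1.
  have := idempotent_central u ww; rewrite !mulrA uv mul1r => vuu.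
  by rewrite -[v * u]mulr1 -{1}uv mulrA vuu.
have u1 : u = 1.
  apply/eqP; rewrite -subr_eq0; apply/eqP/nilpotent_eq0/unip.
  by exists v.
have ae : a * e = e.
  by apply: (addIr (1 - e)); rewrite -/u u1 addrC subrK.
have aae : a * (1 - a) * e = 0 by rewrite -mulrA mulrBl mul1r ae subrr mulr0.
by rewrite -ee -{1}are -[_ * r * e]mulrA -[r * e]eC mulrA aae mul0r.
Qed.

End SemiprimitiveUU.

(* The witness is e = 1 - (1 - a^m)^m, where (a - a^2)^m = 0: it is a multiple
   of a^m, and 1 - e is a multiple of (1 - a)^m. *)
Lemma idempotent_lift (R : pzRingType) (a : R) : nilpotents (a - a ^+ 2) ->
  exists e b : R, [/\ idempotents e, nilpotents b, a = e + b & e * b = b * e].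
Proof.
case=> n; have -> : a - a ^+ 2 = a * (1 - a) by rewrite mulrBr mulr1.
(* A positive exponent lets one factor [a] or [d] be split off below. *)
move=> cn0; have {cn0} : (a * (1 - a)) ^+ n.+1 = 0 by rewrite exprS cn0 mulr0.
set m := n.+1; set d := 1 - a; set c := a * d => cm0.
have ad : GRing.comm a d by apply: commrB; [exact: commr1|].
pose s := (\sum_(i < m) a ^+ i) ^+ m; pose t := \sum_(i < m) (1 - a ^+ m) ^+ i.
have comS x : GRing.comm x a -> GRing.comm x s.
  by move=> xa; apply: commrX; apply: commr_sum => i _; exact: commrX.
have comT x : GRing.comm x a -> GRing.comm x t.
  move=> xa; apply: commr_sum => i _; apply: commrX; apply: commrB; first exact: commr1.
  exact: commrX.
have da : GRing.comm d a := commr_sym ad.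
have ca : GRing.comm c a by apply/commr_sym/commrM.
pose e := 1 - (1 - a ^+ m) ^+ m.
have eE : e = a ^+ m * t.
  by rewrite /e [LHS]sub1rX subKr.
have fE : 1 - e = d ^+ m * s.
  rewrite /e subKr -exprMn_comm; last by apply: commr_sum => i _; exact: commrX.
  by rewrite sub1rX.
have ef : e * (1 - e) = 0.
  rewrite fE eE -mulrA [t * _]mulrA.
  have -> : t * d ^+ m = d ^+ m * t by apply: commrX; apply: commr_sym; exact: comT.
  by rewrite !mulrA -exprMn_comm // cm0 !mul0r.
have ae : GRing.comm a e.
  apply: commrB; first exact: commr1.
  by apply: commrX; apply: commrB; [exact: commr1 | exact: commrX].
clearbody e.
(* Write [a - e = a * (1 - e) - d * e]: the factor [d ^+ m] of [1 - e] and the factor [a ^+ m] of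
   [e] each complete a factor [c]. *)
have bE : a - e = c * (d ^+ n * s - a ^+ n * t).
  have c1 : c * (d ^+ n * s) = a * (1 - e) by rewrite fE exprS !mulrA.
  have c2 : c * (a ^+ n * t) = d * e by rewrite eE exprS !mulrA /c ad.
  by rewrite mulrBr c1 c2 [a * _]mulrBr mulr1 [d * _]mulrBl mul1r opprB addrA subrK.
exists e, (a - e); split.
- by move: ef; rewrite mulrBr mulr1 => /eqP; rewrite subr_eq0 => /eqP.
- exists m; rewrite bE exprMn_comm ?cm0 ?mul0r //.
  apply: commrB; apply: commrM; try by [exact: comS|exact: comT|exact: commrX].
  apply: commrX; apply: commrB; [exact: commr1|exact: ca].
- by rewrite addrC subrK.
- by apply: commrB => //; exact: commr_sym.
Qed.

(** * Strongly nil-clean rings are semipotent and UU *)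

Lemma strongly_nil_clean_UU (R : pzRingType) : strongly_nil_clean R -> UU R.
Proof.
move=> snc; apply/seteqP; split=> [u [v [uv _]]|_ [b nb <-]]; last exact: units_1D_nilpotent.
have [e [b [ee0 nb uE eb]]] := snc u; have ee : e * e = e := ee0.
exists b => //; rewrite uE; congr (_ + b); apply/eqP; rewrite -subr_eq0; apply/eqP.
have fb k : (1 - e) * u ^+ k = (1 - e) * b ^+ k.
  elim: k => // k IH.
  have fu : (1 - e) * u = b * (1 - e).
    by rewrite uE mulrDr mulrBl mul1r ee subrr add0r mulrBl mulrBr mul1r mulr1 eb.
  rewrite exprS mulrA fu -mulrA IH mulrA exprS mulrA; congr (_ * _).
  by rewrite mulrBl mulrBr mul1r mulr1 eb.
case: nb => n bn0.
have un k : u ^+ k * v ^+ k = 1.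
  elim: k => [|k IH]; first by rewrite mulr1.
  by rewrite exprSr exprS mulrA -[_ * u * v]mulrA uv mulr1.
by rewrite -[LHS]mulr1 -[X in _ * X](un n) mulrA fb bn0 mulr0 mul0r.
Qed.

Lemma nil_right_ideal_sub_jacobson (R : pzRingType) (I : set R) :
  right_ideal I -> I `<=` @nilpotents R -> I `<=` @jacobson R.
Proof.
move=> [_ IB IM] nilI x Ix; apply/jacobsonP => r.
have Ixr : I (x * - r) by exact: IM.
by have [v []] := units_1D_nilpotent (nilI _ Ixr); rewrite mulrN; exists v.
Qed.

Lemma strongly_nil_clean_semipotent (R : pzRingType) :
  strongly_nil_clean R -> semipotent R.
Proof.
move=> snc I rI; apply: contra_notP => noidem.
apply: nil_right_ideal_sub_jacobson => // a Ia.
have [e [b [ee0 nb aE eb]]] := snc a; have ee : e * e = e := ee0.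
have [v [bv _]] := units_1D_nilpotent nb.
have aev : a * (e * v) = e.
  by rewrite mulrA aE mulrDl ee -eb -{1}[e]mulr1 -mulrDr -mulrA bv mulr1.
have [e0|e0] := eqVneq e 0; first by rewrite aE e0 add0r.
case: noidem; exists e; split=> //.
by case: rI => _ _ IM; rewrite -aev; exact: IM.
Qed.

(** * Semipotent UU rings are strongly nil-clean *)

Lemma UU_jacobson_nilpotent (R : pzRingType) (j : R) :
  UU R -> jacobson j -> nilpotents j.
Proof.
move=> uuR Jj.
have Jnj : jacobson (- j) by rewrite -sub0r; apply: jacobsonB => //; exact: jacobson0.
have := UU_unit_subr1_nilpotent uuR (units_1B_jacobson Jnj).
by rewrite opprK addrC addKr.
Qed.

Lemma semipotent_UU_sub_sqr (R : pzRingType) (a : R) :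
  semipotent R -> UU R -> jacobson (a - a ^+ 2).
Proof.
move=> spR uuR.
have [S [f [fsurj fker]]] := quotient_ring (@jacobson0 R) (@jacobsonB R)
  (@jacobsonMr R) (@jacobsonMl R).
have feq x y : f x = f y -> jacobson (x - y).
  by move=> fxy; apply/fker; rewrite rmorphB fxy subrr.
have unipS (u : S) : units u -> nilpotents (u - 1).
  have [x <-] := fsurj u; case=> v; have [y <-] := fsurj v.
  rewrite -!rmorphM -(rmorph1 f) => -[/esym/feq xy /esym/feq yx].
  (* Units lift: [x * y] and [y * x] are units, being 1 modulo the radical, so [x] has the right
     inverse [y * p] and the left inverse [q * y]. *)
  have [p []] := units_1B_jacobson xy; rewrite subKr => xyp _.
  have [q [_]] := units_1B_jacobson yx; rewrite subKr => qyx.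
  have ux : units x.
    exists (y * p); split; first by rewrite mulrA.
    by rewrite -(@left_right_inverse_eq _ (q * y) x (y * p)) // -?mulrA // mulrA.
  have [n xn0] := UU_unit_subr1_nilpotent uuR ux.
  by exists n; rewrite -rmorphB -rmorphXn xn0 rmorph0.
have idemS (z : S) : z != 0 -> exists r, idempotents (z * r) /\ z * r != 0.
  have [x <-] := fsurj z => x0.
  pose I := [set y | exists r, y = x * r].
  have rI : right_ideal I.
    split; first by exists 0; rewrite mulr0.
    - by move=> _ _ [r ->] [t ->]; exists (r - t); rewrite mulrBr.
    - by move=> _ t [r ->]; exists (r * t); rewrite mulrA.
  have nIJ : ~ I `<=` @jacobson R.
    move=> /(_ x) Jx; case/negP: x0; apply/eqP/fker; apply: Jx.
    by exists 1; rewrite mulr1.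
  have [_ [[r ->] ee e0]] := spR I rI nIJ.
  exists (f r); rewrite -rmorphM; split.
    by rewrite /idempotents /= -rmorphXn; congr (f _).
  (* The radical contains no nonzero idempotent, so the idempotent survives in the quotient. *)
  by apply: contra_neq e0 => /fker Je; exact: jacobson_idempotent.
apply/fker; rewrite rmorphB rmorphXn expr2.
by rewrite (semiprimitive_UU_boolean unipS idemS) subrr.
Qed.

Theorem theorem2p25 (R : pzRingType) :
  strongly_nil_clean R <-> (semipotent R /\ UU R).
Proof.
split=> [snc|[spR uuR] a].
  by split; [exact: strongly_nil_clean_semipotent | exact: strongly_nil_clean_UU].
apply: idempotent_lift; apply: UU_jacobson_nilpotent => //.
exact: semipotent_UU_sub_sqr.
Qed.
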